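(* Let $g:\mathbb R^N\to\mathbb R$, $g(x)=\max_{i=1,\ldots,\ell}(p_i^Tx+\gamma_i)$, with $(p_i,\gamma_i)\in\mathbb R^N\times\mathbb R$, let $A\in\mathbb R^{m\times N}$, $y\in\mathbb R^m$, $C\in\mathbb R^{p\times N}$, $d\in\mathbb R^p$, and let $f:\mathbb R^m\to\mathbb R$ be a $C^1$ strictly convex function. Consider the problem $$(\mathrm{L}):\quad \min_{x\in\mathbb R^N} f(Ax-y)+g(x)\quad\text{subject to}\quad Cx\ge d,$$ which is assumed to have an optimal solution. Let $x^*\in\mathbb R^N$ be a feasible point of (L), and let $\alpha$, $\mathcal I$, $W$ be as defined in the context. Then $x^*$ is the unique minimizer of (L) if and only if all the following conditions hold: (i) $\{v\in\mathbb R^N \mid Av=0,\ C_{\alpha\bullet}v=0,\ Wv=0\}=\{0\}$; (ii) there exist $z\in\mathbb R^m$, $z'\in\mathbb R^{|\alpha|}_{++}$, and $z''\in\mathbb R^{|\mathcal I|}$ with $0<z''<\mathbf 1$ and $\mathbf 1^Tz''=1$ such that $A^Tz-C_{\alpha\bullet}^Tz'+W^Tz''=0$; (iii) there exist $w\in\mathbb R^{|\alpha|}_+$ and $w'\in\mathbb R^{|\mathcal I|}$ with $0\le w'\le\mathbf 1$ and $\mathbf 1^Tw'=1$ such that $A^T\nabla f(Ax^*-y)-C_{\alpha\bullet}^Tw+W^Tw'=0$.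
   Context: Vector inequalities are componentwise; $\mathbf 1$ is the vector of ones; $\mathbb R^n_+$ and $\mathbb R^n_{++}$ are the nonnegative and (strictly) positive orthants. For a matrix $M$ and row index set $\alpha$, $M_{\alpha\bullet}$ is the submatrix of rows indexed by $\alpha$. Given $x^*$ with $Cx^*\ge d$: $\alpha:=\{i\in\{1,\ldots,p\} \mid (Cx^*-d)_i=0\}$, $\mathcal I:=\{j\in\{1,\ldots,\ell\}\mid p_j^Tx^*+\gamma_j=g(x^* )\}$, and $W\in\mathbb R^{|\mathcal I|\times N}$ is the matrix whose rows are $p_i^T$, $i\in\mathcal I$. It is a standing convention that for each $i\in\mathcal I$, $p_i$ is not a convex combination of the other $p_j$, $j\in\mathcal I$.
   Formalization: In (ii) the strict bound z'' < 1 is required only when |I| ≥ 2; when |I| = 1 the condition 1ᵀz'' = 1 forces z'' = 1, so the printed (ii) is unsatisfiable and the equivalence false (e.g. f(t) = t², g = 0, no constraints, x* = 0). *)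

(* Defs.v *)
From HB Require Import structures.
From mathcomp Require Import all_boot all_order all_algebra.
From mathcomp Require Import boolp classical_sets reals topology normedtype derive.

Set Implicit Arguments.
Unset Strict Implicit.
Unset Printing Implicit Defensive.

Import Order.TTheory GRing.Theory Num.Theory.
Import numFieldNormedType.Exports.

Local Open Scope classical_set_scope.
Local Open Scope ring_scope.

Definition lecv (R : realType) (n : nat) (u v : 'cV[R]_n) : Prop :=
  forall i, u i 0 <= v i 0.

Definition ltcv (R : realType) (n : nat) (u v : 'cV[R]_n) : Prop :=
  forall i, u i 0 < v i 0.

Notation "u <=v v" := (lecv u v) (at level 70, no associativity) : ring_scope.
Notation "u <v v" := (ltcv u v) (at level 70, no associativity) : ring_scope.

Definition ones (R : realType) (n : nat) : 'cV[R]_n := const_mx 1.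

Definition strictly_convex (R : realType) (V : lmodType R) (f : V -> R) : Prop :=
  forall (x y : V) (t : R), x != y -> 0 < t -> t < 1 ->
    f (t *: x + (1 - t) *: y) < t * f x + (1 - t) * f y.

Definition gradient (R : realType) (m : nat) (f : 'cV[R]_m -> R) (x : 'cV[R]_m) :
    'cV[R]_m :=
  \col_i 'D_(delta_mx i 0) f x.

Definition C1 (R : realType) (m : nat) (f : 'cV[R]_m -> R) : Prop :=
  (forall x, differentiable f x) /\ continuous (gradient f).

Definition affine_piece (R : realType) (N l : nat) (p : 'I_l -> 'cV[R]_N)
    (gamma : 'I_l -> R) (i : 'I_l) (x : 'cV[R]_N) : R :=
  ((p i)^T *m x) 0 0 + gamma i.

(* The maximum has l.+1 pieces: it must be nonempty to be defined.  The neutral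
   element supplied to the big operator is itself one of the pieces. *)
Definition max_affine (R : realType) (N l : nat) (p : 'I_l.+1 -> 'cV[R]_N)
    (gamma : 'I_l.+1 -> R) (x : 'cV[R]_N) : R :=
  \big[Num.max/affine_piece p gamma ord0 x]_(i < l.+1) affine_piece p gamma i x.

Definition minimizer (R : realType) (T : Type) (S : set T) (F : T -> R) (x : T) :
    Prop :=
  S x /\ forall y, S y -> F x <= F y.

Definition unique_minimizer (R : realType) (T : Type) (S : set T) (F : T -> R)
    (x : T) : Prop :=
  minimizer S F x /\ forall y, minimizer S F y -> y = x.

Definition feasible (R : realType) (N q : nat) (C : 'M[R]_(q, N)) (d : 'cV[R]_q) :
    set 'cV[R]_N :=
  [set x | d <=v C *m x].

Definition objective (R : realType) (N m l : nat) (f : 'cV[R]_m -> R)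
    (A : 'M[R]_(m, N)) (y : 'cV[R]_m) (p : 'I_l.+1 -> 'cV[R]_N)
    (gamma : 'I_l.+1 -> R) (x : 'cV[R]_N) : R :=
  f (A *m x - y) + max_affine p gamma x.

Definition active_constraints (R : realType) (N q : nat) (C : 'M[R]_(q, N))
    (d : 'cV[R]_q) (x : 'cV[R]_N) : {set 'I_q} :=
  [set i | (C *m x - d) i 0 == 0]%SET.

Definition active_pieces (R : realType) (N l : nat) (p : 'I_l.+1 -> 'cV[R]_N)
    (gamma : 'I_l.+1 -> R) (x : 'cV[R]_N) : {set 'I_l.+1} :=
  [set j | affine_piece p gamma j x == max_affine p gamma x]%SET.

Definition row_block (R : realType) (N q : nat) (alpha : {set 'I_q})
    (C : 'M[R]_(q, N)) : 'M[R]_(#|alpha|, N) :=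
  rowsub (fun k : 'I_#|alpha| => enum_val k) C.

Definition piece_matrix (R : realType) (N l : nat) (p : 'I_l -> 'cV[R]_N)
    (I : {set 'I_l}) : 'M[R]_(#|I|, N) :=
  \matrix_(k < #|I|) (p (enum_val k))^T.

(* When I = [set i] there are no other vectors, the first sum is 0, and this is
   false. *)
Definition convex_combination_of_others (R : realType) (N l : nat)
    (p : 'I_l -> 'cV[R]_N) (I : {set 'I_l}) (i : 'I_l) : Prop :=
  exists c : 'I_l -> R,
    [/\ forall j, 0 <= c j,
        \sum_(j in I | j != i) c j = 1
      & p i = \sum_(j in I | j != i) c j *: p j].

(* Main.v *)
(* Farkas' lemma, applied to the directional derivatives of the objective at [xs],
   shows that (iii) is equivalent to minimality of [xs].  By strict convexity of
   [f], all minimizers have the same [A x], hence the same [g x]; so a minimizer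
   [xs] is unique exactly when the cone [A v = 0, Ca v >= 0, W v <= 0] is trivial,
   which by Stiemke's theorem (Farkas with the right-hand side
   [W^T 1 - Ca^T 1]) is the conjunction of (i) and (ii). *)
Require Import Defs.
From mathcomp Require Import all_boot all_order all_algebra.
From mathcomp Require Import boolp classical_sets reals topology normedtype derive.
From mathcomp Require Import ring lra.

Set Implicit Arguments.
Unset Strict Implicit.
Unset Printing Implicit Defensive.

Import Order.TTheory GRing.Theory Num.Theory.
Import numFieldNormedType.Exports.

Local Open Scope classical_set_scope.
Local Open Scope ring_scope.

(** * Inner products and componentwise order of column vectors *)

Local Notation dot u v := ((u^T *m v) 0 0).

Lemma dotE (R : realType) n (u v : 'cV[R]_n) : dot u v = \sum_i u i 0 * v i 0.
Proof. by rewrite mxE; apply: eq_bigr => i _; rewrite mxE. Qed.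

Lemma dotC (R : realType) n (u v : 'cV[R]_n) : dot u v = dot v u.
Proof. by rewrite !dotE; apply: eq_bigr => i _; rewrite mulrC. Qed.

Lemma dotDr (R : realType) n (u v w : 'cV[R]_n) :
  dot u (v + w) = dot u v + dot u w.
Proof. by rewrite mulmxDr mxE. Qed.

Lemma dotNr (R : realType) n (u v : 'cV[R]_n) : dot u (- v) = - dot u v.
Proof. by rewrite mulmxN mxE. Qed.

Lemma dotZr (R : realType) n a (u v : 'cV[R]_n) : dot u (a *: v) = a * dot u v.
Proof. by rewrite -scalemxAr mxE. Qed.

Lemma dotDl (R : realType) n (u v w : 'cV[R]_n) :
  dot (u + v) w = dot u w + dot v w.
Proof. by rewrite linearD mulmxDl mxE. Qed.

Lemma dotNl (R : realType) n (u v : 'cV[R]_n) : dot (- u) v = - dot u v.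
Proof. by rewrite linearN mulNmx mxE. Qed.

Lemma dot_adjoint (R : realType) k n (M : 'M[R]_(k, n)) (u : 'cV_k) (v : 'cV_n) :
  dot (M^T *m u) v = dot u (M *m v).
Proof. by rewrite trmx_mul trmxK mulmxA. Qed.

Lemma mulmx_dot (R : realType) k n (a : 'cV[R]_k) (u v : 'cV[R]_n) :
  a *m (u^T *m v) = dot u v *: a.
Proof. by rewrite {1}[u^T *m v]mx11_scalar mul_mx_scalar. Qed.

Lemma dot_ge0 (R : realType) n (u v : 'cV[R]_n) :
  0 <=v u -> 0 <=v v -> 0 <= dot u v.
Proof.
move=> u0 v0; rewrite dotE; apply: sumr_ge0 => i _.
by rewrite mulr_ge0 //; [have := u0 i|have := v0 i]; rewrite mxE.
Qed.

(** The terms of the sum are nonnegative, so each vanishes, and the positive factor can be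
    cancelled. This is how the strict signs in (ii) are exploited. *)
Lemma dot_gt0_eq0 (R : realType) n (u v : 'cV[R]_n) :
  0 <v u -> 0 <=v v -> dot u v <= 0 -> v = 0.
Proof.
move=> u0 v0 uv0; apply/colP => i; rewrite [RHS]mxE.
have vge0 j : 0 <= v j 0 by have := v0 j; rewrite mxE.
have ugt0 j : 0 < u j 0 by have := u0 j; rewrite mxE.
have ge0 j : true -> 0 <= u j 0 * v j 0 by move=> _; rewrite mulr_ge0 // ltW.
have /eqP : dot u v = 0.
  by apply/eqP; rewrite eq_le uv0 dotE sumr_ge0.
rewrite dotE psumr_eq0 // => /allP /(_ i (mem_index_enum _)).
by rewrite /= mulf_eq0 gt_eqF //= => /eqP.
Qed.

Lemma dot_ones (R : realType) n (w : 'cV[R]_n) : dot (ones R n) w = \sum_i w i 0.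
Proof. by rewrite dotE; apply: eq_bigr => i _; rewrite mxE mul1r. Qed.

Lemma le_ones (R : realType) n (w : 'cV[R]_n) :
  0 <=v w -> dot (ones R n) w = 1 -> w <=v ones R n.
Proof.
rewrite dot_ones => w0 w1 k; rewrite [leRHS]mxE -w1 (bigD1 k) //= lerDl.
by apply: sumr_ge0 => i _; have := w0 i; rewrite mxE.
Qed.

Lemma lt_ones (R : realType) n (w : 'cV[R]_n) :
  0 <v w -> dot (ones R n) w = 1 -> (1 < n)%N -> w <v ones R n.
Proof.
rewrite dot_ones => w0 w1 n1 k; rewrite [ltRHS]mxE -w1 (bigD1 k) //= ltrDl.
have wgt0 i : 0 < w i 0 by have := w0 i; rewrite mxE.
(* A second, positive entry is what makes the inequality strict. *)
have [j jk] : exists j, j != k.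
  have : (0 < #|predC1 k|)%N by rewrite cardC1 card_ord -subn1 subn_gt0.
  by case/card_gt0P=> j; rewrite !inE; exists j.
rewrite (bigD1 j) //= ltr_pwDl //.
by apply: sumr_ge0 => i _; exact: ltW.
Qed.

(** * Theorems of the alternative *)

(* Bartl's induction on the number of rows: if the last row [c] is needed, some
   [x] satisfies the other constraints with [c x < 0]; projecting along [x]
   onto the kernel of [c] reduces to the other rows. *)
Lemma farkas (R : realType) k n (M : 'M[R]_(k, n)) (b : 'cV[R]_n) :
  (forall v, 0 <=v M *m v -> 0 <= dot b v) ->
  exists2 w : 'cV[R]_k, 0 <=v w & b = M^T *m w.
Proof.
elim: k M b => [|k IH] M b bM.
  exists 0 => [i|]; first by rewrite lexx.
  rewrite mulmx0; apply/colP => i; rewrite [RHS]mxE.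
  have b0 (v : 'cV[R]_n) : 0 <= dot b v by apply: bM => -[].
  have bi (e := delta_mx i 0 : 'cV[R]_n) : dot b e = b i 0.
    by rewrite -colE !mxE.
  apply/eqP; rewrite eq_le -{2}bi b0 andbT -oppr_ge0 -bi -dotNr.
  exact: b0.
move: M bM; rewrite -[k.+1]/(1 + k)%N => M.
rewrite -[M]vsubmxK; set c' := usubmx M; set M' := dsubmx M => bM.
pose c : 'cV_n := c'^T.
have c'E : c' = c^T by rewrite trmxK.
have col_le (v : 'cV[R]_n) : 0 <= dot c v -> 0 <=v M' *m v -> 0 <=v col_mx c' M' *m v.
  move=> cv Mv i; rewrite mul_col_mx !mxE; case: splitP => j _.
    by rewrite (ord1 j) c'E.
  by have := Mv j; rewrite mxE.
case: (EM (forall v, 0 <=v M' *m v -> 0 <= dot b v)) => [bM'|].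
  have [w w0 bE] := IH _ _ bM'; exists (col_mx 0 w) => [i|].
    by rewrite !mxE; case: splitP => j _; [rewrite mxE | have := w0 j; rewrite mxE].
  by rewrite tr_col_mx mul_row_col mulmx0 add0r.
move=> /existsNP[x /not_implyP[Mx /negP]]; rewrite -ltNge => bx.
have cx : dot c x < 0.
  by rewrite ltNge; apply/negP => cx; move: bx; rewrite ltNge bM //; exact: col_le.
pose s : R := (dot c x)^-1.
have s0 : s < 0 by rewrite invr_lt0.
(* [P] is the projection; [M1] is [M'] composed with [P], and [b1] is the image of [b] under the
   transpose of [P]. *)
pose P (v : 'cV[R]_n) : 'cV_n := v - (s * dot c v) *: x.
pose M1 := M' - s *: ((M' *m x) *m c^T).
pose b1 := b - (s * dot b x) *: c.
have b1E (v : 'cV[R]_n) : dot b1 v = dot b (P v).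
  rewrite /b1 /P dotDl dotNl dotDr dotNr dotZr [X in _ - X]dotC dotZr.
  by rewrite (dotC v c); ring.
have M1E (v : 'cV[R]_n) : M1 *m v = M' *m P v.
  rewrite /M1 /P mulmxBl mulmxBr -scalemxAl -scalemxAr -[_ *m c^T *m v]mulmxA.
  by rewrite mulmx_dot scalerA.
have cP (v : 'cV[R]_n) : dot c (P v) = 0.
  by rewrite dotDr dotNr dotZr mulrAC mulVf ?lt_eqF // mul1r subrr.
have [v|w w0 b1w] := IH M1 b1.
  by rewrite M1E b1E => Mv; apply: bM; apply: col_le => //; rewrite cP.
(* Unfolding [b1 = M1^T *m w] leaves this number as the multiplier of [c]; it is a product of two
   nonpositive factors. *)
have r0 : 0 <= s * (dot b x - dot w (M' *m x)).
  apply: mulr_le0; first exact: ltW.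
  by rewrite subr_le0 (le_trans (ltW bx)) //; exact: dot_ge0.
exists (col_mx ((s * (dot b x - dot w (M' *m x)))%:M) w) => [i|].
  rewrite mxE [leRHS]mxE; case: splitP => j _; last by have := w0 j; rewrite mxE.
  by rewrite (ord1 j) mxE eqxx mulr1n.
rewrite tr_col_mx mul_row_col mul_mx_scalar -/c.
have -> : M'^T *m w = b1 + (s * dot w (M' *m x)) *: c.
  rewrite b1w /M1 linearB /= linearZ /= trmx_mul trmxK mulmxBl -scalemxAl.
  rewrite -[c *m _ *m w]mulmxA. rewrite mulmx_dot scalerA (dotC w).
  by rewrite subrK.
rewrite /b1; move: (dot b x) (dot w (M' *m x)) => e g.
by apply/colP => i; rewrite !mxE; ring.
Qed.

(** The equation is split into the rows [A] and [- A]; the difference of their nonnegative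
    multipliers is the sign-free [z]. *)
Lemma farkas_eq (R : realType) m k n (A : 'M[R]_(m, n)) (M : 'M[R]_(k, n))
    (b : 'cV[R]_n) :
  (forall v : 'cV[R]_n, A *m v = 0 -> 0 <=v M *m v -> 0 <= dot b v) ->
  exists z : 'cV[R]_m, exists2 w : 'cV[R]_k, 0 <=v w & b = A^T *m z + M^T *m w.
Proof.
move=> bAM; have [v|w w0 ->] := @farkas R _ _ (col_mx M (col_mx A (- A))) b.
  rewrite !mul_col_mx => Mv.
  have MvE i : 0 <= (M *m v) i 0.
    by have := Mv (lshift _ i); rewrite col_mxEu mxE.
  apply: bAM => [|i]; last by rewrite mxE MvE.
  apply/colP => i; rewrite [RHS]mxE; apply/eqP; rewrite eq_le.
  have := Mv (rshift _ (lshift _ i)); rewrite col_mxEd col_mxEu mxE => ->.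
  have := Mv (rshift _ (rshift _ i)).
  by rewrite !col_mxEd mulNmx [X in _ <= X]mxE mxE oppr_ge0 => ->.
rewrite -[w]vsubmxK -[dsubmx w]vsubmxK.
set w1 := usubmx w; set w2 := usubmx _; set w3 := dsubmx _.
exists (w2 - w3), w1 => [i|].
  by have := w0 (lshift _ i); rewrite !mxE.
by rewrite !tr_col_mx !mul_row_col linearN mulNmx mulmxBr addrC.
Qed.

(** Triviality of the cone makes the Farkas premise hold for [- (M^T *m ones R k)]; moving this
    vector to the other side adds 1 to each multiplier, hence strict positivity. *)
Lemma stiemke (R : realType) m k n (A : 'M[R]_(m, n)) (M : 'M[R]_(k, n)) :
  (forall v : 'cV[R]_n, A *m v = 0 -> 0 <=v M *m v -> v = 0) ->
  exists z : 'cV[R]_m, exists2 w : 'cV[R]_k, 0 <v w & A^T *m z + M^T *m w = 0.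
Proof.
move=> cone0; have [v Av Mv|z [w w0 e]] := @farkas_eq R _ _ _ A M (- (M^T *m ones R k)).
  by rewrite (cone0 v) // mulmx0 mxE.
exists z, (w + ones R k) => [i|].
  by have := w0 i; rewrite !mxE => wi; rewrite ltr_wpDl.
by rewrite mulmxDr addrA -e addNr.
Qed.

(** * Short steps along a direction: constraints and affine pieces *)

Section Directions.
Variables (R : realType) (N : nat).
Implicit Types x v : 'cV[R]_N.

Lemma mul_row_block q (alpha : {set 'I_q}) (C : 'M[R]_(q, N)) v k :
  (row_block alpha C *m v) k 0 = (C *m v) (enum_val k) 0.
Proof. by rewrite mul_rowsub_mx mxE. Qed.

Lemma mul_piece_matrix l (p : 'I_l -> 'cV[R]_N) (I : {set 'I_l}) v k :
  (piece_matrix p I *m v) k 0 = dot (p (enum_val k)) v.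
Proof. by rewrite !mxE; apply: eq_bigr => j _; rewrite !mxE. Qed.

Lemma enum_val_surj (T : finType) (A : {set T}) (a : T) :
  a \in A -> exists k : 'I_#|A|, a = enum_val k.
Proof. by move=> aA; exists (enum_rank_in aA a); rewrite enum_rankK_in. Qed.

(** Common to constraints and pieces: for short steps, slack absorbs any slope, so only the active
    case [a = 0] restricts [b]. *)
Lemma affine_nonpos_near (a b : R) :
  a <= 0 -> (a = 0 -> b <= 0) -> \forall t \near 0^'+, a + t * b <= 0.
Proof.
rewrite le_eqVlt => /orP[/eqP -> /(_ erefl) b0|a0 _].
  near=> t; rewrite add0r mulr_ge0_le0 //.
have b1 : 0 < `|b| + 1 by rewrite ltr_wpDl.
near=> t; rewrite -lerBrDl sub0r.
apply: (@le_trans _ _ (t * (`|b| + 1))).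
  by rewrite ler_wpM2l // ler_wpDr // ler_norm.
rewrite -ler_pdivlMr //.
near: t; apply: nbhs_right_le; rewrite divr_gt0 // oppr_gt0 //.
Unshelve. all: by end_near. Qed.

Lemma feasible_near q (C : 'M[R]_(q, N)) (d : 'cV[R]_q) x v :
  feasible C d x ->
  0 <=v row_block (active_constraints C d x) C *m v ->
  \forall t \near 0^'+, feasible C d (x + t *: v).
Proof.
move=> Cx Cv.
suff : \forall t \near (0 : R)^'+, forall i, (d - C *m x) i 0 + t * (- (C *m v) i 0) <= 0.
  apply: filterS => t le0 i; have := le0 i.
  by rewrite mulmxDr -scalemxAr !mxE mulrN; lra.
apply: filter_forall => i; apply: affine_nonpos_near.
  by have := Cx i; rewrite !mxE; lra.
move=> dCx.
have /enum_val_surj[k iE] : i \in active_constraints C d x.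
  by rewrite inE -opprB mxE dCx oppr0.
by have := Cv k; rewrite mul_row_block -iE mxE oppr_le0.
Qed.

Lemma feasible_direction q (C : 'M[R]_(q, N)) (d : 'cV[R]_q) x v :
  feasible C d v -> 0 <=v row_block (active_constraints C d x) C *m (v - x).
Proof.
move=> Cv k; rewrite mxE mul_row_block.
have := enum_valP k; rewrite inE => /eqP.
by have := Cv (enum_val k); rewrite mulmxBr !mxE; lra.
Qed.

Section MaxAffine.
Variables (l : nat) (p : 'I_l.+1 -> 'cV[R]_N) (gamma : 'I_l.+1 -> R).
Local Notation g := (max_affine p gamma).
Local Notation piece := (affine_piece p gamma).
Local Notation active := (active_pieces p gamma).

Lemma le_max_affine i x : piece i x <= g x.
Proof. exact: (le_bigmax _ (fun i => piece i x)). Qed.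

(** Otherwise all pieces, including the one serving as default value, would lie below [g x], giving
    [g x < g x]. *)
Lemma active_pieces_gt0 x : (0 < #|active x|)%N.
Proof.
rewrite card_gt0; apply/negP => /eqP I0.
have lt_g i : piece i x < g x.
  by rewrite lt_neqAle le_max_affine andbT; have /setP/(_ i) := I0; rewrite !inE => ->.
by have := ltxx (g x); rewrite {1}/max_affine => /bigmax_ltP; case.
Qed.

Lemma affine_piece_line i x v t : piece i (x + t *: v) = piece i x + t * dot (p i) v.
Proof. by rewrite /affine_piece dotDr dotZr addrAC. Qed.

(** Inactive pieces stay below for short steps. The bound [s] is kept free: it becomes a Farkas
    variable for (iii) and is 0 for the cone. *)
Lemma max_affine_near x v s :
  (forall k, (piece_matrix p (active x) *m v) k 0 <= s) ->
  \forall t \near 0^'+, g (x + t *: v) <= g x + t * s.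
Proof.
move=> Wv.
suff : \forall t \near (0 : R)^'+,
    forall i, (piece i x - g x) + t * (dot (p i) v - s) <= 0.
  apply: filterS => t le0; have le_piece i : piece i (x + t *: v) <= g x + t * s.
    by have := le0 i; rewrite affine_piece_line; lra.
  by apply: bigmax_le => // i _; exact: le_piece.
apply: filter_forall => i; apply: affine_nonpos_near.
  by rewrite subr_le0 le_max_affine.
move=> /eqP; rewrite subr_eq0 => ig.
have /enum_val_surj[k iE] : i \in active x by rewrite inE.
by have := Wv k; rewrite mul_piece_matrix -iE subr_le0.
Qed.

End MaxAffine.
End Directions.

(** * One-sided slopes and the gradient inequality *)

Section Gradient.
Variables (R : realType) (m : nat) (f : 'cV[R]_m -> R).
Implicit Types u v : 'cV[R]_m.

Lemma derive_gradient u v : differentiable f u -> 'D_v f u = dot (gradient f u) v.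
Proof.
move=> df; rewrite dotE deriveE // {1}[v]matrix_sum_delta.
rewrite linear_sum; apply: eq_bigr => i _.
by rewrite big_ord1 linearZ /= mxE deriveE // mulrC.
Qed.

Lemma cvg_right_slope u v : differentiable f u ->
  t^-1 * (f (u + t *: v) - f u) @[t --> 0^'+] --> dot (gradient f u) v.
Proof.
move=> df; rewrite -derive_gradient //.
have /cvg_dnbhs_at_right := diff_derivable (v := v) df.
apply: cvg_trans; apply: near_eq_cvg; apply: nearW => t.
by rewrite /= [u + _]addrC.
Qed.

(** By convexity the slopes from [u] towards [v] over steps [t < 1] are at most [f v - f u]; let [t]
    tend to 0. *)
Lemma strictly_convex_tangent u v :
  strictly_convex f -> differentiable f u ->
  f u + dot (gradient f u) (v - u) <= f v.
Proof.
move=> cf df; have [->|uv] := eqVneq v u.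
  by rewrite subrr mulmx0 mxE addr0.
rewrite -lerBrDl. apply: (cvgr_to_le (cvg_right_slope (v := v - u) df)).
near=> t.
have t0 : 0 < t by [].
have t1 : t < 1 by near: t; exact: nbhs_right_lt.
rewrite mulrC ler_pdivrMr //.
have := cf v u t uv t0 t1.
have -> : t *: v + (1 - t) *: u = u + t *: (v - u).
  by rewrite scalerBl scalerBr scale1r addrCA addrA.
by move=> /ltW; lra.
Unshelve. all: by end_near. Qed.

End Gradient.

(** * Multiplier conditions and uniqueness *)

Section Optimality.
Variables (R : realType) (N m q l : nat).
Variables (p : 'I_l.+1 -> 'cV[R]_N) (gamma : 'I_l.+1 -> R).
Variables (A : 'M[R]_(m, N)) (y : 'cV[R]_m) (C : 'M[R]_(q, N)) (d : 'cV[R]_q).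
Variables (f : 'cV[R]_m -> R).
Hypotheses (f_diff : forall u, differentiable f u) (f_convex : strictly_convex f).
Variables (xs : 'cV[R]_N) (xs_feasible : feasible C d xs).
Local Notation X := (feasible C d).
Local Notation F := (objective f A y p gamma).
Local Notation g := (max_affine p gamma).
Local Notation I := (active_pieces p gamma xs).
Local Notation W := (piece_matrix p I).
Local Notation Ca := (row_block (active_constraints C d xs) C).
Local Notation u := (A *m xs - y).

(** A short feasible step changes [g] by at most [t * s], so minimality bounds the slope of [f]
    below by [- s]; pass to the limit. *)
Lemma minimizer_first_order (v : 'cV[R]_N) s :
  minimizer X F xs -> 0 <=v Ca *m v -> (forall k, (W *m v) k 0 <= s) ->
  0 <= dot (A^T *m gradient f u) v + s.
Proof.
move=> [_ xs_min] Cv Wv; rewrite dot_adjoint -lerBlDr sub0r.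
apply: (cvgr_to_ge (cvg_right_slope (v := A *m v) (f_diff u))).
have near_C := feasible_near xs_feasible Cv.
have near_g := max_affine_near (gamma := gamma) Wv.
near=> t.
have t0 : 0 < t by [].
rewrite mulrC ler_pdivlMr //.
have /xs_min : feasible C d (xs + t *: v) by near: t.
have : g (xs + t *: v) <= g xs + t * s by near: t.
rewrite /objective mulmxDr -scalemxAr addrAC; lra.
Unshelve. all: by end_near. Qed.

(* Farkas in the variables [(v, s)] of [minimizer_first_order], where [s] bounds
   [max (W v)]; its coefficient [1] yields [1^T w' = 1]. *)
Lemma minimizer_kkt : minimizer X F xs ->
  exists (w : 'cV[R]_#|active_constraints C d xs|) (w' : 'cV[R]_#|I|),
    [/\ 0 <=v w, 0 <=v w', ((ones R #|I|)^T *m w') 0 0 = 1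
      & A^T *m gradient f u - Ca^T *m w + W^T *m w' = 0].
Proof.
move=> xs_min.
pose M := block_mx Ca 0 (- W) (ones R #|I|).
have [v|w w0] := @farkas R _ _ M (col_mx (A^T *m gradient f u) 1%:M).
  rewrite -[v]vsubmxK /M mul_block_col mul0mx addr0 => Mv.
  rewrite tr_col_mx mul_row_col mxE trmx1 mul1mx.
  apply: minimizer_first_order => // k.
    by have := Mv (lshift _ k); rewrite col_mxEu !mxE.
  have := Mv (rshift _ k); rewrite col_mxEd mulNmx [leLHS]mxE [leRHS]mxE.
  rewrite [X in _ <= X + _ -> _]mxE [X in _ <= _ + X -> _]mxE big_ord1.
  by rewrite [ones _ _ _ _]mxE mul1r addrC subr_ge0.
rewrite -[w]vsubmxK tr_block_mx mul_block_col => /eq_col_mx[e1 e2].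
exists (usubmx w), (dsubmx w); split.
- by move=> i; have := w0 (lshift _ i); rewrite !mxE.
- by move=> i; have := w0 (rshift _ i); rewrite !mxE.
- by move/matrixP/(_ 0 0): e2; rewrite trmx0 mul0mx add0r => <-; rewrite mxE.
- by rewrite e1 linearN mulNmx [Ca^T *m _ - _]addrC addrK addNr.
Qed.

(** The tangent of [f] and the [w']-average of the active pieces minorize the objective; by
    stationarity their total slope is [dot w (Ca *m (x - xs))], which is nonnegative. *)
Lemma kkt_minimizer (w : 'cV[R]_#|active_constraints C d xs|) (w' : 'cV[R]_#|I|) :
  0 <=v w -> 0 <=v w' -> ((ones R #|I|)^T *m w') 0 0 = 1 ->
  A^T *m gradient f u - Ca^T *m w + W^T *m w' = 0 ->
  minimizer X F xs.
Proof.
move=> w0 w'0 w'1 kkt; split=> // x Cx.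
have Cv : 0 <=v Ca *m (x - xs) := feasible_direction Cx.
have gx : g xs + dot w' (W *m (x - xs)) <= g x.
  have gE z : z = \sum_k w' k 0 * z.
    by rewrite -mulr_suml -dot_ones w'1 mul1r.
  rewrite dotE [g xs]gE [g x]gE -big_split /=; apply: ler_sum => k _.
  rewrite -mulrDr ler_wpM2l //; first by have := w'0 k; rewrite mxE.
  rewrite mul_piece_matrix; have := enum_valP k; rewrite inE => /eqP <-.
  by rewrite /affine_piece -addrA addrCA dotDr dotNr subrKC addrC le_max_affine.
have fx := strictly_convex_tangent (A *m x - y) f_convex (f_diff u).
have : dot (A^T *m gradient f u - Ca^T *m w + W^T *m w') (x - xs) = 0.
  by rewrite kkt trmx0 mul0mx mxE.
rewrite !dotDl dotNl !dot_adjoint.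
have wC := dot_ge0 w0 Cv.
move: fx; rewrite opprB addrA subrK -mulmxBr /objective; lra.
Qed.

(* Otherwise, by strict convexity of [f], their midpoint would do better. *)
Lemma minimizers_same_image x : minimizer X F xs -> minimizer X F x ->
  A *m x = A *m xs.
Proof.
move=> [_ xs_min] [Cx x_min].
have FE : F x = F xs by apply/eqP; rewrite eq_le xs_min // x_min.
apply/eqP/negPn/negP => Ax.
pose h : R := 2^-1.
have h0 : 0 < h by rewrite invr_gt0.
have h1 : h < 1 by rewrite invf_lt1 // ltr1n.
pose z := h *: x + (1 - h) *: xs.
have Cz : X z.
  move=> i; rewrite mulmxDr -!scalemxAr.
  have := Cx i; have := xs_feasible i; rewrite !mxE; nra.
have gz : g z <= h * g x + (1 - h) * g xs.
  have le_piece i : affine_piece p gamma i z <= h * g x + (1 - h) * g xs.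
    have := le_max_affine p gamma i x; have := le_max_affine p gamma i xs.
    by rewrite /affine_piece dotDr !dotZr; nra.
  by apply: bigmax_le => // i _; exact: le_piece.
have Axy : A *m x - y != u by apply: contra Ax => /eqP/addIr ->.
have := f_convex Axy h0 h1.
have -> : h *: (A *m x - y) + (1 - h) *: u = A *m z - y.
  by rewrite /z mulmxDr -!scalemxAr; apply/colP => i; rewrite !mxE; ring.
have := xs_min z Cz; move: FE; rewrite /objective; nra.
Qed.

(** A short step along [v] stays feasible, fixes [A x] and does not increase [g], so it reaches
    another minimizer unless [v = 0]. *)
Lemma unique_minimizer_cone (v : 'cV[R]_N) : unique_minimizer X F xs ->
  A *m v = 0 -> 0 <=v Ca *m v -> (forall k, (W *m v) k 0 <= 0) -> v = 0.
Proof.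
move=> [[_ xs_min] xs_uniq] Av Cv Wv.
have near_C := feasible_near xs_feasible Cv.
have near_g := max_affine_near (gamma := gamma) Wv.
have /filter_ex[t [Ct gt t0]] : \forall t \near 0^'+,
    [/\ X (xs + t *: v), g (xs + t *: v) <= g xs + t * 0 & 0 < t].
  by near=> t; split; near: t => //; exact: nbhs_right_gt.
have t_min : minimizer X F (xs + t *: v).
  split=> // x Cx; apply: le_trans (xs_min x Cx).
  rewrite /objective mulmxDr -scalemxAr Av scaler0 addr0 lerD2l.
  by move: gt; rewrite mulr0 addr0.
have /eqP := xs_uniq _ t_min.
by rewrite -subr_eq0 addrC addKr scaler_eq0 gt_eqF //= => /eqP.
Unshelve. all: by end_near. Qed.

End Optimality.

(* If I is a singleton, the last condition on z'' forces z'' = 1, so the strict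
   upper bound z'' < 1 is only required when I has at least two elements. *)
Theorem theorem3p2 (R : realType) (N m q l : nat)
    (p : 'I_l.+1 -> 'cV[R]_N) (gamma : 'I_l.+1 -> R)
    (A : 'M[R]_(m, N)) (y : 'cV[R]_m) (C : 'M[R]_(q, N)) (d : 'cV[R]_q)
    (f : 'cV[R]_m -> R) (f_C1 : C1 f) (f_convex : strictly_convex f)
    (L_solvable : exists x, minimizer (feasible C d) (objective f A y p gamma) x)
    (xs : 'cV[R]_N) (xs_feasible : feasible C d xs) :
  let alpha := active_constraints C d xs in
  let I := active_pieces p gamma xs in
  let W := piece_matrix p I in
  let Ca := row_block alpha C in
  (forall i, i \in I -> ~ convex_combination_of_others p I i) ->
  unique_minimizer (feasible C d) (objective f A y p gamma) xs <->
  [/\ [set v : 'cV[R]_N | [/\ A *m v = 0, Ca *m v = 0 & W *m v = 0]] = [set 0],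
      exists (z : 'cV[R]_m) (z' : 'cV[R]_#|alpha|) (z'' : 'cV[R]_#|I|),
        [/\ 0 <v z',
            0 <v z'',
            (1 < #|I|)%N -> z'' <v ones R #|I|,
            ((ones R #|I|)^T *m z'') 0 0 = 1
          & A^T *m z - Ca^T *m z' + W^T *m z'' = 0]
    & exists (w : 'cV[R]_#|alpha|) (w' : 'cV[R]_#|I|),
        [/\ 0 <=v w,
            0 <=v w',
            w' <=v ones R #|I|,
            ((ones R #|I|)^T *m w') 0 0 = 1
          & A^T *m gradient f (A *m xs - y) - Ca^T *m w + W^T *m w' = 0]].
Proof.
move=> alpha I W Ca _.
have f_diff := f_C1.1.
split=> [xs_uniq|[ker0 [z [z' [z'' [z'0 z''0 _ _ dual]]]] [w [w' [w0 w'0 _ w'1 kkt]]]]].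
  have cone0 := unique_minimizer_cone xs_feasible xs_uniq.
  split.
  - apply/seteqP; split=> [v [Av Cv Wv]|v ->]; last by rewrite /= !mulmx0.
    by apply: cone0 => // k; rewrite ?[Ca *m v]Cv ?[W *m v]Wv // mxE.
  (* The sign conditions of the cone are stacked into one matrix, whose multiplier splits into [w1]
     and [w2]. *)
  - have [v Av|z [w w0 dual]] := @stiemke R _ _ _ A (col_mx Ca (- W)).
      rewrite mul_col_mx mulNmx => Mv; apply: cone0 => // k.
        by have := Mv (lshift _ k); rewrite col_mxEu !mxE.
      by have := Mv (rshift _ k); rewrite col_mxEd [leLHS]mxE [leRHS]mxE oppr_ge0.
    pose w1 := usubmx w; pose w2 := dsubmx w.
    have w10 k : 0 < w1 k 0 by have := w0 (lshift _ k); rewrite !mxE.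
    have w20 k : 0 < w2 k 0 by have := w0 (rshift _ k); rewrite !mxE.
    pose s := dot (ones R #|I|) w2.
    (* Some piece is active, so the positive weights [w2] have a positive sum and can be
       normalized. *)
    have s0 : 0 < s.
      have I0 := active_pieces_gt0 p gamma xs.
      rewrite /s dot_ones (bigD1 (Ordinal I0)) //= ltr_pwDl //.
      by apply: sumr_ge0 => k _; exact: ltW.
    have si0 : 0 < s^-1 by rewrite invr_gt0.
    have zE : dot (ones R #|I|) (s^-1 *: w2) = 1.
      by rewrite dotZr mulVf // gt_eqF.
    have z0 : 0 <v s^-1 *: w2 by move=> k; rewrite mxE [ltRHS]mxE mulr_gt0.
    (* The relation [dual] has the opposite signs on the blocks [Ca] and [W]; scaling by [- s^-1]
       corrects them and negates [z]. *)
    exists (- (s^-1 *: z)), (s^-1 *: w1), (s^-1 *: w2); split=> //.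
    + by move=> k; rewrite mxE [ltRHS]mxE mulr_gt0.
    + exact: lt_ones.
    + move: dual; rewrite -[w]vsubmxK tr_col_mx mul_row_col linearN mulNmx.
      rewrite mulmxN -!scalemxAr -scalerN -scalerBr -scalerDr => dual.
      by rewrite -[RHS](scaler0 _ (- s^-1)) -dual; apply/colP => k; rewrite !mxE; ring.
  - have [w [w' [w0 w'0 w'1 kkt]]] :=
      minimizer_kkt f_diff xs_feasible xs_uniq.1.
    by exists w, w'; split=> //; exact: le_ones.
have xs_min := kkt_minimizer f_diff f_convex xs_feasible w0 w'0 w'1 kkt.
split=> // x x_min; have [Cx _] := x_min.
pose v := x - xs.
have AxE := minimizers_same_image f_convex xs_feasible xs_min x_min.
have Av : A *m v = 0 by rewrite mulmxBr AxE subrr.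
have gE : max_affine p gamma x = max_affine p gamma xs.
  have : objective f A y p gamma x = objective f A y p gamma xs.
    by apply/eqP; rewrite eq_le x_min.2 // xs_min.2.
  by rewrite /objective AxE => /addrI.
have Cv : 0 <=v Ca *m v := feasible_direction Cx.
(* A piece active at [xs] has value [g xs = g x] there and at most [g x] at [x], so it does not
   increase along [v]. *)
have Wv : 0 <=v - (W *m v).
  move=> k; rewrite mxE [leRHS]mxE oppr_ge0 mul_piece_matrix.
  have := enum_valP k; rewrite inE -gE => /eqP xsE.
  have := le_max_affine p gamma (enum_val k) x.
  by rewrite -xsE /affine_piece dotDr dotNr lerD2r subr_le0.
(* Pairing (ii) with [v] removes the [A] term and leaves two nonnegative terms with sum 0. Both
   vanish, and (i) then gives [v = 0]. *)
have dualv : dot z' (Ca *m v) + dot z'' (- (W *m v)) = 0.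
  have : dot (A^T *m z - Ca^T *m z' + W^T *m z'') v = 0.
    by rewrite dual trmx0 mul0mx mxE.
  by rewrite !dotDl dotNl !dot_adjoint Av mulmx0 mxE dotNr; lra.
have nneg n (a : 'cV[R]_n) : 0 <v a -> 0 <=v a by move=> a0 k; exact: ltW.
have Cv_ge0 := dot_ge0 (nneg _ _ z'0) Cv.
have Wv_ge0 := dot_ge0 (nneg _ _ z''0) Wv.
have Cv0 : Ca *m v = 0 by apply: dot_gt0_eq0 z'0 Cv _; lra.
have Wv0 : W *m v = 0.
  by apply: oppr_inj; rewrite oppr0; apply: dot_gt0_eq0 z''0 Wv _; lra.
have : [set v : 'cV[R]_N | [/\ A *m v = 0, Ca *m v = 0 & W *m v = 0]] v by [].
by rewrite ker0 => /eqP; rewrite subr_eq0 => /eqP.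
Qed.
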